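(* Let $L$ be an abelian number field of degree $n$ with Galois group $G=\mathrm{Gal}(L/\mathbb{Q})=\{g_1,\ldots,g_n\}$, ring of integers $\mathcal{O}$, and integral basis $\{\beta_1,\ldots,\beta_n\}$ of $\mathcal{O}$. Let $\alpha'\in L$ be such that $L=\mathbb{Q}[G]\alpha'$ and $\mathcal{O}\subseteq\mathbb{Z}[G]\alpha'$, and let $I=\sum_{j=1}^n\mathbb{Z}[G]b_j$ be the associated ideal of $\mathbb{Z}[G]$, where $b_j\in\mathbb{Z}[G]$ is the element with $\beta_j=b_j\alpha'$. Then $L$ has a normal integral basis if and only if $I$ is principal. More precisely: (1) If $\theta$ is a normal integral basis generator of $L$, and $\theta=t\alpha'$ with $t\in\mathbb{Z}[G]$, then $I=\mathbb{Z}[G]t$. (2) If $I$ is principal and $t\in\mathbb{Z}[G]$ is a generator of $I$, then $t\alpha'$ is a normal integral basis generator of $L$.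
   Context: An abelian number field is a finite Galois extension $L$ of $\mathbb{Q}$ with abelian Galois group $G$. The group rings $\mathbb{Q}[G]$ and $\mathbb{Z}[G]$ act on $L$ by $\left(\sum_{g\in G}a_g g\right)x=\sum_{g\in G}a_g\,g(x)$. An integral basis is a basis of $\mathcal{O}$ as a $\mathbb{Z}$-module. The field $L$ has a normal integral basis if there exists $\theta\in\mathcal{O}$ whose conjugates $g_1(\theta),\ldots,g_n(\theta)$ form a basis of $\mathcal{O}$ as a $\mathbb{Z}$-module; such a $\theta$ is called a normal integral basis generator. Given $\alpha'\in L$ with $L=\mathbb{Q}[G]\alpha'$ (so the elements $g_i(\alpha')$ form a $\mathbb{Q}$-basis of $L$) and $\mathcal{O}\subseteq\mathbb{Z}[G]\alpha'$, one can write uniquely $\beta_j=\sum_{i=1}^n b_{ij}\,g_i(\alpha')$ with $b_{ij}\in\mathbb{Z}$, for $j=1,\ldots,n$; set $b_j=\sum_{i=1}^n b_{ij}g_i\in\mathbb{Z}[G]$, so that $\beta_j=b_j\alpha'$. The ideal $I$ is the ideal of $\mathbb{Z}[G]$ generated by $b_1,\ldots,b_n$. *)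

(* Defs.v *)
From HB Require Import structures.
From mathcomp Require Import all_boot all_order all_fingroup all_algebra.
From mathcomp Require Import all_solvable all_field.

Set Implicit Arguments.
Unset Strict Implicit.
Unset Printing Implicit Defensive.

Import GRing.Theory.
Local Open Scope ring_scope.

(* The group ring R[gT].  An alias of {ffun gT -> R} is needed because the    *)
(* library already equips {ffun gT -> R} with the pointwise product.          *)
Definition group_ring (R : nzRingType) (gT : finGroupType) : Type :=
  {ffun gT -> R}.

Section GroupRing.
Variables (R : nzRingType) (gT : finGroupType).
Local Notation RG := (group_ring R gT).
Implicit Types a b c : RG.

HB.instance Definition _ := GRing.Zmodule.copy RG {ffun gT -> R}.

Definition gr_coef a : gT -> R := fun g => (a : {ffun gT -> R}) g.

Definition gr_one : RG := [ffun g : gT => (g == 1%g)%:R].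

Definition gr_mul a b : RG :=
  [ffun g : gT => \sum_(h : gT) gr_coef a h * gr_coef b (h^-1 * g)%g].

Lemma gr_mulE a b g :
  gr_coef (gr_mul a b) g = \sum_h gr_coef a h * gr_coef b (h^-1 * g)%g.
Proof. exact: ffunE. Qed.

Lemma gr_addE a b g : gr_coef (a + b) g = gr_coef a g + gr_coef b g.
Proof. exact: ffunE. Qed.

Lemma gr_oneE g : gr_coef gr_one g = (g == 1%g)%:R.
Proof. exact: ffunE. Qed.

Lemma gr_eqP a b : gr_coef a =1 gr_coef b -> a = b.
Proof. by move=> eq_ab; apply/ffunP. Qed.

Lemma gr_mulA : associative gr_mul.
Proof.
move=> a b c; apply: gr_eqP => g; rewrite !gr_mulE.
under eq_bigr do rewrite gr_mulE mulr_sumr.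
under [RHS]eq_bigr do rewrite gr_mulE mulr_suml.
rewrite [RHS]exchange_big; apply: eq_bigr => h _ /=.
rewrite [RHS](reindex_inj (mulgI h)); apply: eq_bigr => k _ /=.
by rewrite mulKg invMg mulgA mulrA.
Qed.

Lemma gr_mul1l : left_id gr_one gr_mul.
Proof.
move=> a; apply: gr_eqP => g; rewrite gr_mulE (bigD1 1%g) //= big1 => [|h].
  by rewrite gr_oneE eqxx mul1r addr0 invg1 mul1g.
by move=> /negbTE neq1; rewrite gr_oneE neq1 mul0r.
Qed.

Lemma gr_mul1r : right_id gr_one gr_mul.
Proof.
move=> a; apply: gr_eqP => g; rewrite gr_mulE (bigD1 g) //= big1 => [|h].
  by rewrite gr_oneE mulVg eqxx mulr1 addr0.
move=> /negbTE neqg; rewrite gr_oneE -(inj_eq (mulgI h)) mulKVg mulg1.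
by rewrite eq_sym neqg mulr0.
Qed.

Lemma gr_mulDl : left_distributive gr_mul +%R.
Proof.
move=> a b c; apply: gr_eqP => g; rewrite gr_addE !gr_mulE -big_split /=.
by apply: eq_bigr => h _; rewrite gr_addE mulrDl.
Qed.

Lemma gr_mulDr : right_distributive gr_mul +%R.
Proof.
move=> a b c; apply: gr_eqP => g; rewrite gr_addE !gr_mulE -big_split /=.
by apply: eq_bigr => h _; rewrite gr_addE mulrDr.
Qed.

Lemma gr_oner_neq0 : gr_one != 0.
Proof.
apply/eqP=> /(congr1 (fun a : RG => gr_coef a 1%g)).
by rewrite gr_oneE eqxx /gr_coef ffunE => /eqP; rewrite oner_eq0.
Qed.

HB.instance Definition _ := GRing.Zmodule_isNzRing.Build RG
  gr_mulA gr_mul1l gr_mul1r gr_mulDl gr_mulDr gr_oner_neq0.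

End GroupRing.

(* The library's ideals are proper and decidable subsets; the ideals here may *)
(* be the whole ring.  Left ideals are two-sided when R is commutative.       *)
Section Ideals.
Variable R : nzRingType.

Definition ideal_gen (n : nat) (b : 'I_n -> R) (x : R) : Prop :=
  exists c : 'I_n -> R, x = \sum_(j < n) c j * b j.

Definition multiples (t x : R) : Prop := exists c : R, x = c * t.

Definition generates (t : R) (I : R -> Prop) : Prop :=
  forall x : R, I x <-> multiples t x.

Definition is_principal (I : R -> Prop) : Prop := exists t : R, generates t I.

End Ideals.

Definition is_Zbasis (V : zmodType) (M : V -> Prop) (J : finType) (v : J -> V)
    : Prop :=
  (forall x : V, M x <-> exists c : J -> int, x = \sum_(j : J) v j *~ c j) /\
  (forall c : J -> int, \sum_(j : J) v j *~ c j = 0 -> forall j : J, c j = 0).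

(* gal_of {:L} is the type of all automorphisms of L over the base field.     *)
Lemma gal_fullE (F : fieldType) (L : splittingFieldType F) :
  ('Gal({:L} / 1) = [set: gal_of {:L}])%g.
Proof.
apply/setP=> g; rewrite inE (@gal_kHom _ _ 1%AS {:L}%AS) ?subvf //.
by apply/kAHomP=> u /vlineP[k ->]; rewrite linearZ /= rmorph1.
Qed.

Section NumberField.
Variable L : splittingFieldType rat.
Local Notation G := (gal_of {:L}).

Definition abelian_number_field : Prop :=
  galois 1 {:L} /\ abelian ('Gal({:L} / 1))%g.

Definition ring_of_integers (x : L) : Prop := integralOver (intr : int -> L) x.

(* The library composes automorphisms from left to right,                     *)
(* (g * h)%g x = h (g x); this is immaterial for an abelian Galois group.     *)
Definition Qact (a : group_ring rat G) (x : L) : L :=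
  \sum_(g : G) gr_coef a g *: g x.

Definition Zact (a : group_ring int G) (x : L) : L :=
  \sum_(g : G) g x *~ gr_coef a g.

Definition integral_basis (n : nat) (beta : 'I_n -> L) : Prop :=
  is_Zbasis ring_of_integers beta.

Definition normal_integral_basis_generator (theta : L) : Prop :=
  ring_of_integers theta /\ is_Zbasis ring_of_integers (fun g : G => g theta).

Definition has_normal_integral_basis : Prop :=
  exists theta : L, normal_integral_basis_generator theta.

End NumberField.

(* Main.v *)
(* The Z[G]-linear map a |-> a alpha' from Z[G] to L is injective, because    *)
(* the n conjugates of alpha' span L over Q.  It maps I onto the Galois       *)
(* module O, and I is the full preimage of O.  Hence theta = t alpha' has     *)
(* Z[G] theta = O exactly when Z[G] t = I, and in that case the n conjugates  *)
(* of theta span O, so they are automatically independent.                    *)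
Require Import Defs.
From mathcomp Require Import all_boot all_order all_fingroup all_algebra.
From mathcomp Require Import all_solvable all_field.

Set Implicit Arguments.
Unset Strict Implicit.
Unset Printing Implicit Defensive.

Import GRing.Theory Num.Theory.
Local Open Scope ring_scope.

(** Multiplication by [alpha'] is an isomorphism of Z[G]-modules from I onto O: it is injective on
    Z[G] ([Zact_alpha_inj]), I is the preimage of O ([ideal_genE]), and [alphaZ] gives surjectivity.
    Module generators therefore correspond, t to [Zact t alpha']. A generator of a normal integral
    basis also needs Z-independent conjugates, which follows by counting dimensions over Q. *)

Section LinearIndependence.

Lemma free_codomP (F : fieldType) (V : vectType F) (J : finType) (v : J -> V) :
  free (codom v) <->
  (forall c : J -> F, \sum_j c j *: v j = 0 -> forall j, c j = 0).
Proof.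
have szv : size (codom v) == #|J| by rewrite size_codom.
pose X := Tuple szv.
have nthX (i : 'I_#|J|) : X`_i = v (enum_val i).
  by rewrite (nth_map (enum_val i)) -?cardE // -enum_val_nth.
have sumX (k : 'I_#|J| -> F) : \sum_(i < #|J|) k i *: X`_i
    = \sum_j k (enum_rank j) *: v j.
  rewrite (reindex enum_rank) /=; last by apply/onW_bij/enum_rank_bij.
  by apply: eq_bigr => j _; rewrite nthX enum_rankK.
split=> [/(@freeP _ _ _ X) freeX c c0 j | indep].
  rewrite -[j]enum_rankK; apply: (freeX (c \o enum_val)).
  by rewrite sumX -[RHS]c0; apply: eq_bigr => i _; rewrite /= enum_rankK.
apply/(@freeP _ _ _ X) => k; rewrite sumX => /indep k0 i.
by rewrite -[i]enum_valK k0.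
Qed.

Lemma free_full (F : fieldType) (V : vectType F) (J : finType) (v : J -> V) :
  #|J| = \dim {:V} -> (fullv <= <<codom v>>)%VS -> free (codom v).
Proof.
move=> cardJ spanv; apply: (@basis_free _ _ fullv).
by rewrite basisEdim spanv size_codom cardJ leqnn.
Qed.

Lemma full_free (F : fieldType) (V : vectType F) (J : finType) (v : J -> V) :
  #|J| = \dim {:V} -> free (codom v) -> (fullv <= <<codom v>>)%VS.
Proof.
move=> cardJ freev.
suff /span_basis -> : basis_of fullv (codom v) by [].
by rewrite basisEfree freev subvf size_codom cardJ leqnn.
Qed.

(** Clearing denominators turns a rational relation into an integral one. *)
Lemma Zindep_free (V : vectType rat) (J : finType) (v : J -> V) :
  (forall c : J -> int, \sum_j v j *~ c j = 0 -> forall j, c j = 0) ->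
  free (codom v).
Proof.
move=> indep; apply/free_codomP => a a0.
pose d : int := \prod_j denq (a j).
have d_neq0 : d != 0 by apply/prodf_neq0 => j _; apply: denq_neq0.
(* This is [d * a j] as an integer: the numerator of [a j] times the denominators of the other
   coefficients. *)
pose c j : int := numq (a j) * \prod_(i | i != j) denq (a i).
have cE j : (c j)%:~R = d%:~R * a j.
  rewrite /c /d [in RHS](bigD1 j) //= !intrM.
  by rewrite [RHS]mulrC mulrA -numqE.
have c0 : \sum_j v j *~ c j = 0.
  rewrite -[RHS](scaler0 _ d%:~R) -[in RHS]a0 scaler_sumr; apply: eq_bigr => j _.
  by rewrite -scaler_int cE scalerA.
move=> j; apply/eqP; have := cE j; rewrite (indep _ c0) mulr0z => /esym/eqP.
by rewrite mulf_eq0 intr_eq0 (negPf d_neq0).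
Qed.

End LinearIndependence.

Section GroupRingAction.
Variable L : splittingFieldType rat.
Local Notation G := (gal_of {:L}).
Implicit Types (a b : group_ring int G) (x y : L).

Lemma ZactDl a b x : Zact (a + b) x = Zact a x + Zact b x.
Proof.
by rewrite /Zact -big_split; apply: eq_bigr => g _; rewrite gr_addE mulrzDr.
Qed.

Lemma Zact0l x : Zact 0 x = 0.
Proof. by apply: (addIr (Zact 0 x)); rewrite -ZactDl !add0r. Qed.

Lemma ZactBl a b x : Zact (a - b) x = Zact a x - Zact b x.
Proof. by apply: (addIr (Zact b x)); rewrite -ZactDl !subrK. Qed.

Lemma Zact_suml (n : nat) (a : 'I_n -> group_ring int G) x :
  Zact (\sum_j a j) x = \sum_j Zact (a j) x.
Proof.
apply: (big_morph (fun a => Zact a x)) => [u v|]; first exact: ZactDl.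
exact: Zact0l.
Qed.

Lemma Zact_mulrz a (m : int) x : Zact (a *~ m) x = Zact a x *~ m.
Proof.
have aMn k : Zact (a *+ k) x = Zact a x *+ k.
  by elim: k => [|k IHk]; rewrite ?Zact0l // !mulrS ZactDl IHk.
case: m => k; rewrite ?NegzE ?mulrNz -!pmulrn ?aMn //.
by rewrite -[- (a *+ _)]sub0r ZactBl Zact0l sub0r aMn.
Qed.

(** An automorphism fixes integer coefficients, so [g x] is a root of the same monic polynomial as
    [x]. *)
Lemma ring_of_integers_gal (g : G) x :
  ring_of_integers x -> ring_of_integers (g x).
Proof.
case=> p p_monic px0; exists p => //.
have -> : map_poly (intr : int -> L) p = map_poly g (map_poly intr p).
  by rewrite -map_poly_comp; apply: eq_map_poly => z /=; rewrite rmorph_int.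
by rewrite (fmorph_root g).
Qed.

Lemma ring_of_integersMz x (m : int) :
  ring_of_integers x -> ring_of_integers (x *~ m).
Proof.
by move=> Ox; rewrite -mulrzr; apply: integral_mul => //; apply: integral_id.
Qed.

Lemma ring_of_integers_sum (J : finType) (F : J -> L) :
  (forall j, ring_of_integers (F j)) -> ring_of_integers (\sum_j F j).
Proof.
move=> OF; elim/big_ind: _ => // [|x y]; last exact: integral_add.
exact: integral0.
Qed.

Lemma ring_of_integers_Zact a x :
  ring_of_integers x -> ring_of_integers (Zact a x).
Proof.
move=> Ox; apply: ring_of_integers_sum => g.
exact/ring_of_integersMz/ring_of_integers_gal.
Qed.

Hypothesis abL : abelian ('Gal({:L} / 1))%g.

(** Commutativity reverses the library's order of composition, as [ZactM] needs for L to be a left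
    Z[G]-module. *)
Lemma galMC (g h : G) x : (g * h)%g x = g (h x).
Proof.
have -> : (g * h = h * g)%g.
  by apply: (centsP abL); rewrite gal_fullE inE.
by rewrite galM ?memvf.
Qed.

Lemma ZactM a b x : Zact (a * b) x = Zact a (Zact b x).
Proof.
rewrite /Zact.
under eq_bigr => g _.
  rewrite [gr_coef _ _]gr_mulE mulrz_sumr.
  over.
rewrite exchange_big; apply: eq_bigr => h _ /=.
(* Substituting g = hk turns the coefficient of [b] at [h^-1 * g] into the one at k. *)
rewrite raddf_sum mulrz_suml (reindex_inj (mulgI h)) /=.
apply: eq_bigr => k _.
by rewrite mulKg galMC raddfMz -mulrzA mulrC.
Qed.

End GroupRingAction.

Section AssociatedIdeal.
Variables (L : splittingFieldType rat) (n : nat) (beta : 'I_n -> L).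
Variables (alpha' : L) (b : 'I_n -> group_ring int (gal_of {:L})).
Local Notation G := (gal_of {:L}).
Hypothesis anfL : abelian_number_field L.
Hypothesis dimL : n = \dim {:L}.
Hypothesis betaZ : integral_basis beta.
Hypothesis alphaQ :
  forall x : L, exists a : group_ring rat G, x = Qact a alpha'.
Hypothesis alphaZ : forall x : L, ring_of_integers x ->
  exists a : group_ring int G, x = Zact a alpha'.
Hypothesis betaE : forall j, beta j = Zact (b j) alpha'.

Let abL := proj2 anfL.

Lemma card_gal_dim : #|{: G}| = \dim {:L}.
Proof. by rewrite -cardsT -gal_fullE -(galois_dim (proj1 anfL)) dimv1 divn1. Qed.

(** By [alphaQ] the conjugates of [alpha'] span L; being as many as the dimension, they are free, so
    [a - c] has zero coefficients. *)
Lemma Zact_alpha_inj (a c : group_ring int G) :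
  Zact a alpha' = Zact c alpha' -> a = c.
Proof.
move=> eq_ac; apply/eqP; rewrite -subr_eq0; apply/eqP/gr_eqP => g.
have /free_codomP indep : free (codom (fun g : G => g alpha')).
  apply: free_full; first exact: card_gal_dim.
  apply/subvP => x _; have [q ->] := alphaQ x.
  by apply: memv_suml => h _; apply/memvZ/memv_span/codom_f.
have /indep/(_ g)/eqP : \sum_(g : G) (gr_coef (a - c) g)%:~R *: g alpha' = 0.
  transitivity (Zact (a - c) alpha'); last by rewrite ZactBl eq_ac subrr.
  by apply: eq_bigr => h _; rewrite scaler_int.
by rewrite intr_eq0 => /eqP ->; rewrite /gr_coef ffunE.
Qed.

Lemma ring_of_integers_beta j : ring_of_integers (beta j).
Proof.
apply/(proj1 betaZ); exists (fun i => (i == j)%:R).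
rewrite (bigD1 j) //= eqxx big1 ?addr0 // => i /negPf ->.
exact: mulr0z.
Qed.

(** I lands in O because O is stable under Z[G]. Conversely, integer coordinates of [Zact a alpha']
    on [beta] lift through injectivity to an expression of [a] in the [b j]. *)
Lemma ideal_genE (a : group_ring int G) :
  ideal_gen b a <-> ring_of_integers (Zact a alpha').
Proof.
split=> [[c ->] | /(proj1 betaZ)[c Ec]].
  rewrite Zact_suml; apply: ring_of_integers_sum => j; rewrite ZactM // -betaE.
  exact/ring_of_integers_Zact/ring_of_integers_beta.
(* The integer coordinates, seen as constants of Z[G]. *)
exists (fun j => (1 : group_ring int G) *~ c j); apply: Zact_alpha_inj.
rewrite Ec Zact_suml; apply: eq_bigr => j _.
by rewrite mulrzl Zact_mulrz betaE.
Qed.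

Lemma normal_generator_generates (t : group_ring int G) :
  normal_integral_basis_generator (Zact t alpha') -> generates t (ideal_gen b).
Proof.
move=> [Ot [spanO _]] x; split=> [/ideal_genE/spanO[c Ec] | [c ->]].
  (* The coordinates of [Zact x alpha'] on the conjugates of theta are the coefficients of the
     cofactor of t. *)
  exists ([ffun g => c g] : group_ring int G); apply: Zact_alpha_inj.
  rewrite ZactM // Ec; apply: eq_bigr => g _.
  by rewrite /gr_coef ffunE.
by apply/ideal_genE; rewrite ZactM //; apply: ring_of_integers_Zact.
Qed.

Lemma generates_normal_generator (t : group_ring int G) :
  generates t (ideal_gen b) -> normal_integral_basis_generator (Zact t alpha').
Proof.
move=> genI; set theta := Zact t alpha'.
have Otheta : ring_of_integers theta.
  by apply/ideal_genE/genI; exists 1; rewrite mul1r.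
(* Write x as [Zact a alpha']; then [a] lies in I, so it is a multiple of [t]. *)
have spanO x : ring_of_integers x -> exists c, x = Zact c theta.
  move=> Ox; have [a Ea] := alphaZ Ox; move: Ox; rewrite Ea.
  by move=> /ideal_genE/genI[c ->]; exists c; rewrite ZactM.
split=> //; split=> [x | ].
  split=> [/spanO[c ->] | [c ->]]; first by exists (gr_coef c).
  apply: ring_of_integers_sum => g.
  exact/ring_of_integersMz/ring_of_integers_gal.
(* The n = #|G| conjugates of theta span the Q-basis beta of L, hence are
   linearly independent. *)
have /free_codomP indep : free (codom (fun g : G => g theta)).
  apply: free_full; first exact: card_gal_dim.
  have := full_free (etrans (card_ord n) dimL) (Zindep_free (proj2 betaZ)).
  move=> /subv_trans-> //; apply/span_subvP => _ /codomP[j ->].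
  have [c ->] := spanO _ (ring_of_integers_beta j).
  apply: memv_suml => g _; rewrite -scaler_int.
  exact/memvZ/memv_span/codom_f.
move=> c c0 g; apply/eqP; rewrite -(intr_eq0 rat).
apply/eqP; apply: (indep (fun h => (c h)%:~R)); rewrite -[RHS]c0.
by apply: eq_bigr => h _; rewrite scaler_int.
Qed.

End AssociatedIdeal.

Theorem theorem2p2 (L : splittingFieldType rat) (n : nat)
    (beta : 'I_n -> L) (alpha' : L) (b : 'I_n -> group_ring int (gal_of {:L})) :
  abelian_number_field L ->
  n = \dim {:L} ->
  integral_basis beta ->
  (forall x : L, exists a : group_ring rat (gal_of {:L}), x = Qact a alpha') ->
  (forall x : L, ring_of_integers x ->
     exists a : group_ring int (gal_of {:L}), x = Zact a alpha') ->
  (forall j : 'I_n, beta j = Zact (b j) alpha') ->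
  (has_normal_integral_basis L <-> is_principal (ideal_gen b)) /\
  (forall (theta : L) (t : group_ring int (gal_of {:L})),
     normal_integral_basis_generator theta -> theta = Zact t alpha' ->
     generates t (ideal_gen b)) /\
  (forall t : group_ring int (gal_of {:L}),
     generates t (ideal_gen b) ->
     normal_integral_basis_generator (Zact t alpha')).
Proof.
move=> anfL dimL betaZ alphaQ alphaZ betaE.
have nibg_gen t : normal_integral_basis_generator (Zact t alpha') ->
    generates t (ideal_gen b).
  exact: (normal_generator_generates anfL betaZ alphaQ betaE).
have gen_nibg t : generates t (ideal_gen b) ->
    normal_integral_basis_generator (Zact t alpha').
  exact: (generates_normal_generator anfL dimL betaZ alphaQ alphaZ betaE).
split; last by split=> // theta t nibg_theta Et; apply: nibg_gen; rewrite -Et.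
split=> [[theta nibg_theta] | [t /gen_nibg]]; last by exists (Zact t alpha').
(* Integrality of theta provides the t that part (1) takes as given. *)
have [t Et] := alphaZ _ (proj1 nibg_theta).
by exists t; apply: nibg_gen; rewrite -Et.
Qed.
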